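(* Let $G$ be a $3$-regular graph of girth $g(G)\ge 6$. Then $G$ realizes the sequence $(2,2,2,2)$.
   Context: Graphs are finite, simple and connected. The girth $g(G)$ is the length of a shortest cycle of $G$. Given a proper coloring of $G$, a vertex $v$ is a color-dominating vertex (CDV) if its closed neighborhood $N[v]$ contains all colors used in the coloring. A b-coloring is a proper coloring in which every color class contains at least one CDV. $G$ realizes a finite non-increasing sequence $(s_1,\dots,s_k)$ of positive integers if $G$ has a b-coloring with exactly $k$ colors in which, for each $i\in\{1,\dots,k\}$, the $i$th color class contains at least $s_i$ CDVs. *)

(* Defs.v *)
From mathcomp Require Import all_boot.

Set Implicit Arguments.
Unset Strict Implicit.
Unset Printing Implicit Defensive.

Record sgraph := SGraph {
  vertex :> finType;
  edge : rel vertex;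
  edge_sym : symmetric edge;
  edge_irr : irreflexive edge }.

Arguments edge {G} : rename.

Section Graph.
Variable G : sgraph.

Definition nbh (v : G) : {set G} := [set u | edge v u].
Definition cl_nbh (v : G) : {set G} := v |: nbh v.

Definition regular (d : nat) : Prop := forall v : G, #|nbh v| = d.

(* The graph with no vertex is not counted as connected. *)
Definition connected_graph : Prop :=
  0 < #|G| /\ forall u v : G, connect edge u v.

(* [ucycle] accepts x, y with x adjacent to y as a closed walk of length 2;
   the size condition rules this out. *)
Definition graph_cycle (c : seq G) : Prop := 2 < size c /\ ucycle edge c.

(* Relational, since the girth of an acyclic graph is undefined. *)
Definition is_girth (g : nat) : Prop :=
  (exists2 c : seq G, graph_cycle c & size c = g) /\
  (forall c : seq G, graph_cycle c -> g <= size c).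

Section Coloring.
Variable k : nat.
Implicit Type f : {ffun G -> 'I_k}.

Definition colors_used f : {set 'I_k} := [set f v | v : G].

Definition proper_coloring f : Prop := forall u v : G, edge u v -> f u != f v.

Definition cdv f (v : G) : bool := colors_used f \subset [set f u | u in cl_nbh v].

Definition b_coloring f : Prop :=
  proper_coloring f /\
  (forall i, i \in colors_used f -> exists2 v : G, f v = i & cdv f v).

End Coloring.

(* Intended for non-increasing sequences of positive integers. *)
Definition realizes (s : seq nat) : Prop :=
  exists f : {ffun G -> 'I_(size s)},
    [/\ b_coloring f,
        #|colors_used f| = size s &
        forall i : 'I_(size s), nth 0 s i <= #|[set v | (f v == i) && cdv f v]|].

End Graph.

(* Main.v *)
(** In a cubic graph any proper partial 4-coloring extends greedily, so it is
    enough to color a small configuration properly with two color-dominating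
    vertices in each color. Four configurations suffice: if the girth is 6, a
    theta graph made of three paths of length 3, or else a hexagon in which no
    two antipodal vertices have adjacent outer neighbors, with color 3 on all
    six outer neighbors; if the girth is 7, a heptagon with its outer neighbors;
    if the girth is at least 8, the ball of radius 2 around an edge. In the last
    three cases the children of one or two outer neighbors are added to obtain
    the missing color-dominating vertices; girth at least 5 gives enough freedom
    in coloring these children. *)

Require Import Defs.
From mathcomp Require Import all_boot zify.

Set Implicit Arguments.
Unset Strict Implicit.
Unset Printing Implicit Defensive.

(** Induction on the number of vertices outside [A]. The values of [f] outside [A] are placeholders;
    fewer than [k] neighbors cannot carry all [k] values, so a new vertex can take a color absent
    from its whole neighborhood. *)
Lemma greedy_extension (G : sgraph) (k : nat) (A : {set G})
    (f : {ffun G -> 'I_k}) :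
  (forall v : G, #|nbh v| < k) ->
  {in A &, forall u v, edge u v -> f u != f v} ->
  exists2 h : {ffun G -> 'I_k}, proper_coloring h & {in A, h =1 f}.
Proof.
move=> deg; have [n] := ubnP #|~: A|.
elim: n A f => // n IHn A f ltAn fP.
have [w wA | allA] := pickP [pred w | w \notin A]; last first.
  exists f => // u v; apply: fP; [have := allA u | have := allA v];
    by move/negbFE.
have [c cP] : exists c, c \notin [set f u | u in nbh w].
  apply/existsP; rewrite -negb_forall; apply/negP => /forallP full.
  have := leq_ltn_trans (leq_imset_card f (mem (nbh w))) (deg w).
  rewrite ltnNge => /negP[]; rewrite -[X in X <= _]card_ord.
  by apply/subset_leq_card/subsetP => c _; apply: full.
pose f' := [ffun v => if v == w then c else f v].
have cN u : edge w u -> c != f u.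
  by move=> wu; apply: contraNneq cP => ->; apply: imset_f; rewrite inE.
have [||h hP hA] := IHn (w |: A) f'.
- apply: (@leq_trans #|~: A|); last by rewrite -ltnS.
  apply: proper_card; apply/properP; split.
    by rewrite setCS subsetUr.
  by exists w; rewrite !inE ?eqxx.
- move=> u v; rewrite !inE !ffunE.
  have [-> _|_ /= uA] := eqVneq u w; have [->|_ /= vA] := eqVneq v w.
  + by rewrite edge_irr.
  + by move=> wu; apply: cN.
  + by move=> _; rewrite edge_sym eq_sym; apply: cN.
  + exact: fP.
exists h => // v vA; rewrite hA ?inE ?vA ?orbT // ffunE.
by case: eqP vA wA => //= -> ->.
Qed.

(** * Non-backtracking walks and girth *)

Definition girth_ge (G : sgraph) (m : nat) : Prop :=
  forall c : seq G, graph_cycle c -> m <= size c.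

(** Backtracking is tested inside the walk only: a closed walk may turn back at its base point. *)
Fixpoint nbwalk (G : sgraph) (x : G) (p : seq G) : bool :=
  if p is y :: q then
    [&& edge x y, (if q is z :: _ then x != z else true) & nbwalk y q]
  else true.

Lemma nbwalk_cat (G : sgraph) (x : G) (p q : seq G) :
  nbwalk x (p ++ q) -> nbwalk x p && nbwalk (last x p) q.
Proof.
elim: p x => //= y p IHp x /and3P[-> xz /IHp/andP[-> ->]].
by case: p xz {IHp} => //= z p ->.
Qed.

Lemma nbwalk_path (G : sgraph) (x : G) (p : seq G) :
  nbwalk x p -> path edge x p.
Proof. by elim: p x => //= y p IHp x /and3P[-> _ /IHp]. Qed.

(** A closed non-backtracking walk contains a cycle no longer than itself: without repetition it is
    a cycle, since length 1 would be a loop and length 2 a backtrack; otherwise the part between two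
    visits to a vertex is a shorter closed walk of the same kind. *)
Lemma nbwalk_neq (G : sgraph) (m : nat) (x : G) (p : seq G) :
  girth_ge G m -> nbwalk x p -> 0 < size p < m -> x != last x p.
Proof.
move=> gm; have [n] := ubnP (size p); elim: n x p => // n IHn x p ltpn.
move=> xp /andP[p0 pm]; apply/negP => /eqP x_last.
have [up|] := boolP (uniq p).
  have cp : ucycle edge p.
    rewrite /ucycle up andbT; case: p x_last xp {ltpn p0 pm up} => //= y p.
    by rewrite rcons_path => <- /and3P[-> _ /nbwalk_path ->].
  have [p2|p2] := ltnP 2 (size p); first by have := gm p (conj p2 cp); rewrite leqNgt pm.
  case: p p0 p2 x_last xp {cp ltpn up pm} => [|y [|z []]] //= _ _ <-.
    by rewrite edge_irr.
  by rewrite eqxx andbF.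
move=> nup.
have [p1 [y [p2 [p3 def_p]]]] :
    exists p1 y p2 p3, p = p1 ++ y :: p2 ++ y :: p3.
  elim: p nup {IHn ltpn xp p0 pm x_last} => //= z p IHp.
  rewrite negb_and negbK; have [zp _|_ /IHp] := boolP (z \in p).
    by case/splitPr: zp => p2 p3; exists [::], z, p2, p3.
  by move=> [p1 [y [p2 [p3 ->]]]]; exists (z :: p1), y, p2, p3.
have sz : size (rcons p2 y) < size p.
  by rewrite def_p !size_cat /= !size_cat size_rcons /=; lia.
have yp2 : nbwalk y (rcons p2 y).
  move: xp; rewrite def_p -cat_rcons -[_ ++ y :: p3]cat_rcons.
  by case/nbwalk_cat/andP=> _ /nbwalk_cat/andP[]; rewrite last_rcons.
have := IHn y _ (leq_trans sz _) yp2; rewrite last_rcons eqxx size_rcons /=.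
move=> /(_ ltpn) ; rewrite -(size_rcons p2 y) (ltn_trans sz pm) => /(_ isT).
by [].
Qed.

Lemma nbwalk_nonadj (G : sgraph) (m : nat) (x : G) (p : seq G) :
  girth_ge G m -> nbwalk x p -> 1 < size p < m.-1 -> ~~ edge x (last x p).
Proof.
move=> gm xp /andP[p1 pm]; apply/negP => xz; set z := last x p in xz.
have zxp : nbwalk z (x :: p).
  rewrite /= edge_sym xz xp; case: p p1 pm xp @z xz => //= y p p1 pm.
  (* Prepending [z] must not backtrack, so [z] has to differ from the second vertex [y] of the walk;
     this is [nbwalk_neq] for the walk from [y]. *)
  case/and3P=> _ _ yp _; rewrite andbT eq_sym.
  by apply: (nbwalk_neq gm yp); lia.
by have := nbwalk_neq gm zxp; rewrite /= eqxx; move/(_ ltac:(lia)).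
Qed.

(** * Lists of known neighbors *)

Definition star (G : sgraph) (v : G) (t : seq G) : bool :=
  uniq t && all (edge v) t.

Lemma star_extend (G : sgraph) (d : nat) (v : G) (t : seq G) :
  regular G d -> star v t -> size t < d -> exists a, star v (a :: t).
Proof.
move=> reg /andP[ut vt] td.
have : ~~ (nbh v \subset t).
  apply: contraL td => /subset_leq_card; rewrite reg -leqNgt => /leq_trans.
  by apply; apply: card_size.
case/subsetPn=> a; rewrite inE => va ta.
by exists a; rewrite /star /= ta ut va.
Qed.

Lemma edge_star (G : sgraph) (u v : G) : edge u v -> star v [:: u].
Proof. by rewrite /star /= edge_sym => ->. Qed.

(** If both further neighbors of [y] were adjacent to [x], they would form a 4-cycle with [x] and
    [y]; one that is not adjacent is named [b]. *)
Lemma star_extend_avoid (G : sgraph) (m : nat) (x y w : G) :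
  regular G 3 -> girth_ge G m -> 4 < m -> x != y -> star y [:: w] ->
  exists a b, star y [:: a; b; w] /\ ~~ edge x b.
Proof.
move=> reg gm m4 xy yw.
have [b yb] := star_extend reg yw isT; have [a yP] := star_extend reg yb isT.
have [xb|] := boolP (edge x b); last by exists a, b.
have [xa|] := boolP (edge x a); last first.
  exists b, a; split=> //; move: yP; rewrite /star /= !inE (eq_sym b a) !negb_or.
  by case/and5P=> /and3P[/andP[-> ->] -> _] -> -> -> _.
have := yP; rewrite /star /= !inE !negb_or => /and5P[/and3P[/andP[ab _] _ _] ya {}yb _ _].
suff: x != last x [:: a; y; b; x] by rewrite eqxx.
apply: (nbwalk_neq gm) => //=.
by rewrite xa xy [edge a y]edge_sym ya ab yb (edge_sym b) xb eq_sym xy.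
Qed.

(** * Patterns, their validity and their occurrences *)

(* A configuration on the names 0, 1, ..: [adj] lists known neighbors of each
   name, [col] is the coloring to be extended, and [nonadj] lists pairs that are
   assumed non-adjacent. Distinct names may denote the same vertex. *)
Record pattern := Pattern {
  adj : seq (seq nat);
  col : seq nat;
  nonadj : seq (nat * nat) }.

Section Pattern.
Variable H : pattern.

Definition nbrs (i : nat) : seq nat := nth [::] (adj H) i.

(* The ends of the non-backtracking walks of length d.+1 that start i, j. *)
Fixpoint reach (d i j : nat) : seq nat :=
  if d is d'.+1 then
    flatten [seq reach d' j l | l <- nbrs j & (l != i) && (i \in nbrs j)]
  else [:: j].

Definition sphere (d i : nat) : seq nat := flatten [seq reach d i j | j <- nbrs i].

Definition avoid (i j : nat) : bool :=
  ((i, j) \in nonadj H) || ((j, i) \in nonadj H).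

(** As [sphere d] belongs to length [d.+1], the lengths tested are 2 to [m - 2]: an edge would close
    such a walk below length [m]. *)
Definition never_adjacent (m i j : nat) : bool :=
  [|| i == j, avoid i j | has (fun d => j \in sphere d i) (iota 1 (m - 3))].

(** A vertex differs from every neighbor of a vertex that it is not adjacent to; the walks have
    lengths 1 to [m - 1]. *)
Definition never_equal (m i j : nat) : bool :=
  [|| has (avoid i) (nbrs j), has (avoid j) (nbrs i)
    | has (fun d => j \in sphere d i) (iota 0 (m - 1))].

Definition rainbow (i : nat) : bool :=
  all (mem [seq nth 0 (col H) j | j <- i :: nbrs i]) (iota 0 4).

(* Two names for one vertex, or an edge not listed in [adj], are harmless unless
   they break properness; a non-backtracking walk shorter than the girth excludes
   this. *)
Definition valid_pattern (m : nat) : bool :=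
  let n := size (col H) in let c := nth 0 (col H) in
  [&& all (fun k => k < 4) (col H),
      all (all (fun j => j < n)) (adj H),
      all (fun i => all (fun j =>
        if c i == c j then never_adjacent m i j else never_equal m i j)
        (iota 0 n)) (iota 0 n)
    & all (fun k => has (fun i => has (fun j =>
        [&& c i == k, c j == k, rainbow i, rainbow j & never_equal m i j])
        (iota 0 n)) (iota 0 n)) (iota 0 4)].

Variables (G : sgraph) (x0 : G) (s : seq G).
Let phi i : G := nth x0 s i.

Definition occurs : Prop :=
  [/\ size s = size (col H),
      all (fun i => star (phi i) [seq phi j | j <- nbrs i]) (iota 0 (size (adj H)))
    & all (fun e => ~~ edge (phi e.1) (phi e.2)) (nonadj H)].

Hypothesis Hs : occurs.

Lemma star_phi i : star (phi i) [seq phi j | j <- nbrs i].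
Proof.
have [lti|gei] := ltnP i (size (adj H)); last by rewrite /nbrs nth_default.
by case: Hs => _ /allP/(_ i) + _; apply; rewrite mem_iota.
Qed.

Lemma edge_phi i j : j \in nbrs i -> edge (phi i) (phi j).
Proof. by have /andP[_ /allP h] := star_phi i; move=> ij; apply/h/map_f. Qed.

Lemma nbrs_phi_neq i j l :
  j \in nbrs i -> l \in nbrs i -> j != l -> phi j != phi l.
Proof.
move=> ij il; apply: contra_neq => jl.
have /andP[u _] := star_phi i; move: jl.
rewrite -(nth_index 0 ij) -(nth_index 0 il) -!(nth_map 0 x0) ?index_mem //.
by move/eqP; rewrite nth_uniq ?size_map ?index_mem // => /eqP->.
Qed.

Lemma reach_walk d i j l : j \in nbrs i -> l \in reach d i j ->
  exists p, [/\ nbwalk (phi i) (phi j :: p), size p = d & last (phi j) p = phi l].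
Proof.
elim: d i j => [|d IHd] i j ij.
  by rewrite inE => /eqP->; exists [::]; rewrite /= edge_phi.
case/flatten_mapP=> k; rewrite mem_filter => /andP[/andP[ki ji] jk].
case/(IHd _ _ jk)=> p [wp sp lp]; exists (phi k :: p); split=> //=; last by rewrite sp.
(* Different names are sure to denote different vertices only within one neighbor list, hence the
   test [i \in nbrs j] in [reach]. *)
by rewrite edge_phi //= (nbrs_phi_neq ji jk) 1?eq_sym.
Qed.

Lemma sphere_walk d i l : l \in sphere d i ->
  exists p, [/\ nbwalk (phi i) p, size p = d.+1 & last (phi i) p = phi l].
Proof.
case/flatten_mapP=> j ij /(reach_walk ij)[p [wp sp lp]].
by exists (phi j :: p); rewrite /= sp.
Qed.

Lemma avoid_phi i j : avoid i j -> ~~ edge (phi i) (phi j).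
Proof.
have [_ _ /allP h] := Hs.
by case/orP=> /h //=; rewrite edge_sym.
Qed.

Variable m : nat.
Hypothesis gm : girth_ge G m.

Lemma never_equal_phi i j : never_equal m i j -> phi i != phi j.
Proof.
case/or3P=> /hasP[k].
- move=> jk /avoid_phi; apply: contraNneq => ->; exact: edge_phi.
- move=> ik /avoid_phi; apply: contraNneq => <-; exact: edge_phi.
rewrite mem_iota => km /sphere_walk[p [wp sp <-]].
by apply: (nbwalk_neq gm); rewrite ?sp //; lia.
Qed.

Lemma never_adjacent_phi i j : never_adjacent m i j -> ~~ edge (phi i) (phi j).
Proof.
case/or3P=> [/eqP->|/avoid_phi //|/hasP[k]]; first by rewrite edge_irr.
rewrite mem_iota => km /sphere_walk[p [wp sp <-]].
by apply: (nbwalk_nonadj gm); rewrite ?sp //; lia.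
Qed.

Lemma valid_pattern_realizes :
  regular G 3 -> valid_pattern m -> realizes G [:: 2; 2; 2; 2].
Proof.
move=> reg /and4P[/allP col4 /allP adjn /allP pairs /allP twice].
have [szs _ _] := Hs; set n := size (col H) in adjn pairs twice.
pose c := nth 0 (col H).
have c4 i : c i < 4.
  have [lti|gei] := ltnP i n; last by rewrite /c nth_default.
  exact/col4/mem_nth.
have n_io i : i < n -> i \in iota 0 n by rewrite mem_iota.
(* A vertex takes the color of its first name. Off [s] the default 0 is harmless, since the
   extension has to agree with [f] on [s] only. *)
pose f : {ffun G -> 'I_4} := [ffun v => inord (c (index v s))].
have fE i : i < n -> f (phi i) = inord (c i).
  move=> lti; rewrite ffunE; congr inord.
  have phis : phi i \in s by rewrite mem_nth ?szs.
  have ltj : index (phi i) s < n by rewrite /n -szs index_mem.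
  (* Names of different colors denote different vertices, so all names of one vertex share its
     color. *)
  have /allP/(_ _ (n_io _ ltj)) := pairs _ (n_io _ lti).
  case: ifP => [/eqP cij _|_ /never_equal_phi]; first by rewrite /c cij.
  by rewrite {2}/phi nth_index ?eqxx.
have inord_c i j : (inord (c i) == inord (c j) :> 'I_4) = (c i == c j).
  by rewrite -val_eqE /= !inordK.
have [||h hP hs] := @greedy_extension G 4 [set v in s] f.
- by move=> v; rewrite reg.
- move=> u v; rewrite !inE => us vs.
  have ui : index u s < n by rewrite /n -szs index_mem.
  have vi : index v s < n by rewrite /n -szs index_mem.
  have /allP/(_ _ (n_io _ vi)) := pairs _ (n_io _ ui).
  rewrite !ffunE inord_c; case: ifP => // _ /never_adjacent_phi.
  by rewrite /phi !nth_index // => /negPf->.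
have hE i : i < n -> h (phi i) = inord (c i).
  by move=> lti; rewrite hs ?fE // inE mem_nth ?szs.
have cdvP i : i < n -> rainbow i -> cdv h (phi i).
  move=> lti /allP ri; apply/subsetP => k _.
  have /ri/mapP[j ij kj] : val k \in iota 0 4 by rewrite mem_iota ltn_ord.
  have -> : k = inord (c j) by apply: val_inj; rewrite /= inordK.
  have ltj : j < n.
    move: ij; rewrite inE => /predU1P[-> //|ij].
    have [adji|adji] := ltnP i (size (adj H)).
      by have /allP/(_ _ ij) := adjn _ (mem_nth [::] adji).
    by move: ij; rewrite /nbrs nth_default.
  rewrite -hE //; apply: imset_f; rewrite !inE.
  by move: ij; rewrite inE => /predU1P[->|/edge_phi->]; rewrite ?eqxx ?orbT.
have two (k : 'I_4) : 1 < #|[set v | (h v == k) && cdv h v]|.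
  have /twice/hasP[i] : val k \in iota 0 4 by rewrite mem_iota ltn_ord.
  rewrite mem_iota => lti /hasP[j]; rewrite mem_iota => ltj.
  case/and5P=> /eqP cik /eqP cjk ri rj /never_equal_phi ij.
  suff /subset_leq_card : [set phi i; phi j] \subset [set v | (h v == k) && cdv h v].
    by rewrite cards2 ij.
  apply/subsetP => v; rewrite !inE.
  case/orP=> /eqP->; rewrite hE // cdvP // andbT -val_eqE /= inordK //.
    by rewrite /c cik.
  by rewrite /c cjk.
have used (k : 'I_4) : exists2 v, h v = k & cdv h v.
  have /card_gt0P[v] := ltnW (two k).
  by rewrite inE => /andP[/eqP hv cv]; exists v.
exists h; split.
- by split=> // k _; apply: used.
- rewrite -[RHS]card_ord; apply/eq_card => k; rewrite inE.
  by have [v <- _] := used k; apply: imset_f.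
by case=> [[|[|[|[|]]]] lt4] //; apply: two.
Qed.
End Pattern.

(** * The four colored patterns *)

(* In the patterns with a cycle, the cycle carries the first names. The theta
   graph is on 0..7 with branch vertices 0 and 3. *)
Definition theta_pattern := Pattern
  [:: [:: 6; 5; 1]; [:: 9; 0; 2]; [:: 10; 1; 3]; [:: 7; 2; 4]; [:: 11; 3; 5];
      [:: 12; 4; 0]; [:: 8; 7; 0]; [:: 13; 6; 3]; [:: 6]; [:: 1]; [:: 2];
      [:: 4]; [:: 5]; [:: 7]]
  [:: 0; 1; 2; 0; 3; 2; 3; 1; 2; 3; 3; 1; 1; 2] [::].

(** The color-dominating vertices are the hexagon and, for color 3, 6 and 7. Each pair in [nonadj]
    has one color and is joined by a walk of length 5, which an edge could close to a 6-cycle. *)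
Definition hexagon_pattern := Pattern
  [:: [:: 6; 5; 1]; [:: 7; 0; 2]; [:: 8; 1; 3]; [:: 9; 2; 4]; [:: 10; 3; 5];
      [:: 11; 4; 0]; [:: 12; 13; 0]; [:: 14; 15; 1]; [:: 2]; [:: 3]; [:: 4];
      [:: 5]; [:: 6]; [:: 6]; [:: 7]; [:: 7]]
  [:: 0; 1; 2; 0; 1; 2; 3; 3; 3; 3; 3; 3; 1; 2; 0; 2]
  [:: (6, 9); (7, 10); (8, 11); (13, 15)].

(** The heptagon contains one color-dominating vertex of color 3; the outer neighbor 8 is the
    second. *)
Definition heptagon_pattern := Pattern
  [:: [:: 7; 6; 1]; [:: 8; 0; 2]; [:: 9; 1; 3]; [:: 10; 2; 4]; [:: 11; 3; 5];
      [:: 12; 4; 6]; [:: 13; 5; 0]; [:: 0]; [:: 14; 15; 1]; [:: 2]; [:: 3];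
      [:: 4]; [:: 5]; [:: 6]; [:: 8]; [:: 8]]
  [:: 0; 1; 2; 0; 1; 2; 3; 2; 3; 3; 3; 3; 0; 1; 2; 0] [:: (12, 15)].

(** The color-dominating vertices are the ends 0 and 1 of the edge, their neighbors 2 to 5, and 6
    and 10. The leaves 14 and 17 share color 3 and are joined by a walk of length 7. *)
Definition edge_pattern := Pattern
  [:: [:: 3; 2; 1]; [:: 5; 4; 0]; [:: 7; 6; 0]; [:: 9; 8; 0]; [:: 11; 10; 1];
      [:: 13; 12; 1]; [:: 15; 14; 2]; [:: 2]; [:: 3]; [:: 3]; [:: 16; 17; 4];
      [:: 4]; [:: 5]; [:: 5]; [:: 6]; [:: 6]; [:: 10]; [:: 10]]
  [:: 0; 1; 2; 3; 2; 3; 1; 3; 1; 2; 0; 3; 0; 2; 3; 0; 1; 3] [:: (14, 17)].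

Lemma theta_valid : valid_pattern theta_pattern 6.
Proof. by vm_compute. Qed.
Lemma hexagon_valid : valid_pattern hexagon_pattern 6.
Proof. by vm_compute. Qed.
Lemma heptagon_valid : valid_pattern heptagon_pattern 7.
Proof. by vm_compute. Qed.
Lemma edge_valid : valid_pattern edge_pattern 8.
Proof. by vm_compute. Qed.

Ltac split_andb :=
  repeat match goal with |- is_true (_ && _) => apply/andP; split end.

Ltac star_facts :=
  repeat match goal with
  | H : is_true (star _ _) |- _ => rewrite /star /= ?inE ?negb_or in H
  | H : is_true (_ && _) |- _ => case/andP: H => ? ?
  end.

Ltac from_stars :=
  star_facts; rewrite /star /= ?inE ?negb_or; split_andb;
  by [ | rewrite edge_sym | rewrite eq_sym].

(** The lists in [adj] follow the order in which [star_extend] adds neighbors, so the larger stars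
    are hypotheses verbatim; one-element stars come from single edges. *)
Ltac occurs_from_stars :=
  split; rewrite // /nbrs /=; split_andb => //; apply: edge_star; from_stars.

(** * Finding the patterns in a cubic graph *)

Section Realizations.
Variable G : sgraph.
Hypothesis reg : regular G 3.

Lemma star_extend2 (v w : G) : star v [:: w] -> exists a b, star v [:: a; b; w].
Proof.
move=> vw; have [b vb] := star_extend reg vw isT.
by have [a va] := star_extend reg vb isT; exists a, b.
Qed.

Lemma realizes_theta (p0 p1 p2 p3 p4 p5 q0 q1 q2 q3 q4 q5 : G) :
  girth_ge G 6 ->
  star p0 [:: q0; p5; p1] -> star p1 [:: q1; p0; p2] ->
  star p2 [:: q2; p1; p3] -> star p3 [:: q3; p2; p4] ->
  star p4 [:: q4; p3; p5] -> star p5 [:: q5; p4; p0] ->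
  edge q0 q3 -> realizes G [:: 2; 2; 2; 2].
Proof.
move=> g6 S0 S1 S2 S3 S4 S5 e03.
have p0q3 : p0 != q3.
  by apply: (@nbwalk_neq G 6 p0 [:: p1; p2; p3; q3] g6) => //; from_stars.
have p3q0 : p3 != q0.
  by apply: (@nbwalk_neq G 6 p3 [:: p2; p1; p0; q0] g6) => //; from_stars.
have Q0 : star q0 [:: q3; p0] by from_stars.
have Q3 : star q3 [:: q0; p3] by from_stars.
have [r0 R0] := star_extend reg Q0 isT; have [r3 R3] := star_extend reg Q3 isT.
apply: (@valid_pattern_realizes theta_pattern G p0
  [:: p0; p1; p2; p3; p4; p5; q0; q3; r0; q1; q2; q4; q5; r3]
  _ _ g6 reg theta_valid).
by occurs_from_stars.
Qed.

Lemma realizes_hexagon (c : seq G) :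
  girth_ge G 6 -> graph_cycle c -> size c = 6 -> realizes G [:: 2; 2; 2; 2].
Proof.
move=> g6 [_ /andP[]]; case: c => [|p0 [|p1 [|p2 [|p3 [|p4 [|p5 []]]]]]] //=.
rewrite !inE !negb_or => cc uc _.
have [q0 S0] := @star_extend G 3 p0 [:: p5; p1] reg ltac:(from_stars) isT.
have [q1 S1] := @star_extend G 3 p1 [:: p0; p2] reg ltac:(from_stars) isT.
have [q2 S2] := @star_extend G 3 p2 [:: p1; p3] reg ltac:(from_stars) isT.
have [q3 S3] := @star_extend G 3 p3 [:: p2; p4] reg ltac:(from_stars) isT.
have [q4 S4] := @star_extend G 3 p4 [:: p3; p5] reg ltac:(from_stars) isT.
have [q5 S5] := @star_extend G 3 p5 [:: p4; p0] reg ltac:(from_stars) isT.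
(* Adjacent outer neighbors of antipodal vertices yield a theta graph; rotating the hexagon covers
   the three pairs. *)
have [|n03] := boolP (edge q0 q3); first exact: (realizes_theta g6 S0 S1 S2 S3 S4 S5).
have [|n14] := boolP (edge q1 q4); first exact: (realizes_theta g6 S1 S2 S3 S4 S5 S0).
have [|n25] := boolP (edge q2 q5); first exact: (realizes_theta g6 S2 S3 S4 S5 S0 S1).
have [r [r0 R0]] : exists r r', star q0 [:: r; r'; p0].
  by apply: star_extend2; from_stars.
have r0q1 : r0 != q1.
  by apply: (@nbwalk_neq G 6 r0 [:: q0; p0; p1; q1] g6) => //; from_stars.
have [t [t1 [T1 n01]]] : exists t t', star q1 [:: t; t'; p1] /\ ~~ edge r0 t'.
  by apply: (star_extend_avoid reg g6) => //; from_stars.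
apply: (@valid_pattern_realizes hexagon_pattern G p0
  [:: p0; p1; p2; p3; p4; p5; q0; q1; q2; q3; q4; q5; r; r0; t; t1]
  _ _ g6 reg hexagon_valid).
by occurs_from_stars.
Qed.

Lemma realizes_heptagon (c : seq G) :
  girth_ge G 7 -> graph_cycle c -> size c = 7 -> realizes G [:: 2; 2; 2; 2].
Proof.
move=> g7 [_ /andP[]]; case: c => [|p0 [|p1 [|p2 [|p3 [|p4 [|p5 [|p6 []]]]]]]] //=.
rewrite !inE !negb_or => cc uc _.
have [q0 S0] := @star_extend G 3 p0 [:: p6; p1] reg ltac:(from_stars) isT.
have [q1 S1] := @star_extend G 3 p1 [:: p0; p2] reg ltac:(from_stars) isT.
have [q2 S2] := @star_extend G 3 p2 [:: p1; p3] reg ltac:(from_stars) isT.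
have [q3 S3] := @star_extend G 3 p3 [:: p2; p4] reg ltac:(from_stars) isT.
have [q4 S4] := @star_extend G 3 p4 [:: p3; p5] reg ltac:(from_stars) isT.
have [q5 S5] := @star_extend G 3 p5 [:: p4; p6] reg ltac:(from_stars) isT.
have [q6 S6] := @star_extend G 3 p6 [:: p5; p0] reg ltac:(from_stars) isT.
have q51 : q5 != q1.
  by apply: (@nbwalk_neq G 7 q5 [:: p5; p6; p0; p1; q1] g7) => //; from_stars.
have [t [t1 [T1 n51]]] : exists t t', star q1 [:: t; t'; p1] /\ ~~ edge q5 t'.
  by apply: (star_extend_avoid reg g7) => //; from_stars.
apply: (@valid_pattern_realizes heptagon_pattern G p0
  [:: p0; p1; p2; p3; p4; p5; p6; q0; q1; q2; q3; q4; q5; q6; t; t1]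
  _ _ g7 reg heptagon_valid).
by occurs_from_stars.
Qed.

Lemma realizes_edge (u : G) : girth_ge G 8 -> realizes G [:: 2; 2; 2; 2].
Proof.
move=> g8.
have [v uv] : exists v, star u [:: v] by apply: (star_extend reg).
have [u2 [u1 U]] := star_extend2 uv.
have [v2 [v1 V]] : exists a b, star v [:: a; b; u].
  by apply: star_extend2; from_stars.
have [x1' [x1 X1]] : exists a b, star u1 [:: a; b; u].
  by apply: star_extend2; from_stars.
have [x2' [x2 X2]] : exists a b, star u2 [:: a; b; u].
  by apply: star_extend2; from_stars.
have [y1' [y1 Y1]] : exists a b, star v1 [:: a; b; v].
  by apply: star_extend2; from_stars.
have [y2' [y2 Y2]] : exists a b, star v2 [:: a; b; v].
  by apply: star_extend2; from_stars.
have [r' [r R]] : exists a b, star x1 [:: a; b; u1].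
  by apply: star_extend2; from_stars.
have ry : r != y1.
  by apply: (@nbwalk_neq G 8 r [:: x1; u1; u; v; v1; y1] g8) => //; from_stars.
have [t' [t [T nrt]]] : exists a b, star y1 [:: a; b; v1] /\ ~~ edge r b.
  by apply: (star_extend_avoid reg g8) => //; from_stars.
apply: (@valid_pattern_realizes edge_pattern G u
  [:: u; v; u1; u2; v1; v2; x1; x1'; x2; x2'; y1; y1'; y2; y2'; r; r'; t'; t]
  _ _ g8 reg edge_valid).
by occurs_from_stars.
Qed.
End Realizations.

Theorem theorem5p4 (G : sgraph) (g : nat) :
  connected_graph G -> regular G 3 -> is_girth G g -> 6 <= g ->
  realizes G [:: 2; 2; 2; 2].
Proof.
move=> [/card_gt0P[u _] _] reg [[c cycc szc] gg] g6.
have gm m : m <= g -> girth_ge G m.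
  by move=> mg c' /gg; apply: leq_trans.
have [g8|g8] := leqP 8 g; first exact: (realizes_edge reg u (gm _ g8)).
have [g7|g7] := leqP 7 g.
  by apply: (realizes_heptagon reg (gm _ g7) cycc); lia.
by apply: (realizes_hexagon reg (gm _ g6) cycc); lia.
Qed.
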